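(* Let $m$ be the mean and $v$ the (unknown, finite) variance of the sample distribution. For each assumed variance bound $v_0\in\mathbb{R}_+$, let $\widehat\theta(v_0)$ be some estimator of the mean depending on $v_0$, and let $\delta(v_0,\eta)\in\mathbb{R}_+\cup\{+\infty\}$ be the corresponding confidence bound: whenever the variance bound is valid, that is $v\le v_0$, with probability at least $1-2\eta$, $$|m-\widehat\theta(v_0)|\le\delta(v_0,\eta).$$ Let $\nu$ be an atomic sub-probability measure on the positive real line $\mathbb{R}_+$, let $\epsilon$ be a confidence parameter, and let $I(v_0)$ and $J(v_1)$ be the associated random closed intervals defined in the context. Then: (i) Since $v_1\mapsto J(v_1)$ is a nondecreasing family of closed intervals, the intersection $$\bigcap\bigl\{J(v_1):v_1\in\mathbb{R}_+,\ J(v_1)\ne\varnothing\bigr\}$$ is a nonempty closed interval, and one can therefore pick an adaptive estimator $\widetilde\theta$ belonging to it, choosing for instance the middle of this interval. (ii) With probability at least $1-2\epsilon$, $m\in J(v)$, which implies that $J(v)\neq\varnothing$, and therefore that $\widetilde\theta\in J(v)$. Thus with probability at least $1-2\epsilon$, $$|m-\widetilde\theta|\le|J(v)|\le2\inf_{v_0>v}\delta\bigl(v_0,\epsilon\,\nu(v_0)\bigr),$$ where $|J(v)|$ is the length of $J(v)$. (iii) If the confidence bound is homogeneous, in the sense that $\delta(v_0,\eta)=\delta(1,\eta)\sqrt{v_0}$, then with probability at least $1-2\epsilon$, $$|m-\widetilde\theta|\le2\inf_{v_0>v}\delta\bigl(1,\epsilon\,\nu(v_0)\bigr)\sqrt{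v_0}.$$
   Context: ''Atomic sub-probability measure'' means that $\nu$ is carried by countably many points with $\sum_{v_0}\nu(v_0)\le1$, where $\nu(v_0)$ is the mass at $v_0$ (zero outside the support); it serves to take a union bound on a countable set of possible values of $v_0$. For any $v_0$ such that $\delta(v_0,\epsilon\nu(v_0))<+\infty$, $$I(v_0)=\Bigl[\widehat\theta(v_0)-\delta\bigl(v_0,\epsilon\nu(v_0)\bigr),\ \widehat\theta(v_0)+\delta\bigl(v_0,\epsilon\nu(v_0)\bigr)\Bigr],$$ and $I(v_0)=\mathbb{R}$ when $\delta(v_0,\epsilon\nu(v_0))=+\infty$. (Presumably, except for distributions with bounded support, $\delta(v_0,0)=+\infty$; this is a remark, not a hypothesis.) For $v_1\in\mathbb{R}_+$, $$J(v_1)=\bigcap\bigl\{I(v_0):v_0\ge v_1\bigr\}.$$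
   Formalization: Parts (ii) and (iii) additionally assume that almost surely |m−θ̂(v0)| ≤ δ(v0,0) for all v0 ≥ v simultaneously (automatic if δ(v0,0)=+∞); otherwise uncountably many null exceptional sets can make J(v) empty always. *)

(* Defs.v *)
From HB Require Import structures.
From mathcomp Require Import all_boot all_order all_algebra.
From mathcomp Require Import all_classical all_reals all_analysis.

Set Implicit Arguments.
Unset Strict Implicit.
Unset Printing Implicit Defensive.

Import Order.TTheory GRing.Theory Num.Theory.
Import numFieldNormedType.Exports.

Local Open Scope classical_set_scope.
Local Open Scope ring_scope.

(* The event E may involve an uncountable intersection and need not be
   measurable, so "with probability at least p" is inner probability. For
   measurable E this is equivalent to p%:E <= P E. *)
Definition with_prob_ge (d : measure_display) (T : measurableType d)
    (R : realType) (P : probability T R) (p : R) (E : set T) : Prop :=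
  exists A : set T, [/\ measurable A, A `<=` E & (p%:E <= P A)%E].

Definition closed_interval (R : realType) (A : set R) : Prop :=
  closed A /\ is_interval A.

(* All the X_i follow the sample distribution mu; nothing is assumed on
   their joint law. *)
Definition sample_of (d : measure_display) (T : measurableType d)
    (R : realType) (P : probability T R) (mu : probability (measurableTypeR R) R)
    (n : nat) (X : {mfun T >-> n.-tuple (measurableTypeR R)}) : Prop :=
  forall (i : 'I_n) (B : set (measurableTypeR R)), measurable B ->
    P [set w | B (tnth (X w) i)] = mu B.

Definition atomic_on_Rplus (R : realType)
    (nu : subprobability (measurableTypeR R) R) : Prop :=
  exists D : set R,
    [/\ countable D, D `<=` [set x : R | 0 <= x] & nu (~` D) = 0%E].

Definition mass (R : realType) (nu : subprobability (measurableTypeR R) R)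
    (x : R) : R := fine (nu [set x]).

Section adaptive.
Context {R : realType} {n : nat}.

(* thetahat v0 x is the estimator under the variance bound v0, evaluated at
   the sample x; only v0 >= 0 (and eta >= 0) matter below. *)
Variables (thetahat : R -> {mfun n.-tuple (measurableTypeR R) >-> measurableTypeR R})
          (delta : R -> R -> \bar R)
          (nu : subprobability (measurableTypeR R) R) (eps : R).

Definition Iint (x : n.-tuple (measurableTypeR R)) (v0 : R) : set R :=
  let e := delta v0 (eps * mass nu v0) in
  if (e < +oo)%E
  then `[thetahat v0 x - fine e, thetahat v0 x + fine e]%classic
  else setT.

Definition Jint (x : n.-tuple (measurableTypeR R)) (v1 : R) : set R :=
  \bigcap_(v0 in [set v0 | v1 <= v0]) Iint x v0.

Definition Kint (x : n.-tuple (measurableTypeR R)) : set R :=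
  \bigcap_(v1 in [set v1 | 0 <= v1 /\ Jint x v1 !=set0]) Jint x v1.

(* No measurability is required of the selection. *)
Definition adaptive_estimator
    (thetatilde : n.-tuple (measurableTypeR R) -> R) : Prop :=
  forall x, Kint x (thetatilde x).

End adaptive.

(* The real-valued inf and sup are 0 on unbounded sets, so middle setT = 0. *)
Definition middle (R : realType) (A : set R) : R := (inf A + sup A) / 2.

Section confidence.
Context {d : measure_display} {T : measurableType d} {R : realType} {n : nat}.
Variables (P : probability T R)
  (X : {mfun T >-> n.-tuple (measurableTypeR R)}) (m v : R)
  (thetahat : R -> {mfun n.-tuple (measurableTypeR R) >-> measurableTypeR R})
  (delta : R -> R -> \bar R).

Definition confidence_bound : Prop :=
  forall v0 eta : R, 0 <= v0 -> 0 <= eta -> v <= v0 ->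
    with_prob_ge P (1 - 2 * eta)
      [set w | (`|m - thetahat v0 (X w)|%:E <= delta v0 eta)%E].

(* At level eta = 0, confidence_bound gives one null set for each v0. The
   interval Iint uses level 0 at every v0 that is not an atom, so these
   uncountably many null sets have to be contained in a single one. This is
   automatic when delta v0 0 = +oo, when the level 0 bounds hold surely
   (bounded support), or when delta v0 0 is finite only on a countable set. *)
Definition level0_uniform : Prop :=
  {ae P, forall w, forall v0 : R, v <= v0 ->
     (`|m - thetahat v0 (X w)|%:E <= delta v0 0)%E}.

End confidence.

(* Main.v *)
Require Import Defs.
From HB Require Import structures.
From mathcomp Require Import all_boot all_order all_algebra.
From mathcomp Require Import all_classical all_reals all_analysis.

Set Implicit Arguments.
Unset Strict Implicit.
Unset Printing Implicit Defensive.

Import Order.TTheory GRing.Theory Num.Theory.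
Import numFieldNormedType.Exports.

Local Open Scope classical_set_scope.
Local Open Scope ring_scope.

(** The deterministic part (i) is a compactness argument. Each I(v0) is either
    the whole line or a compact interval, and so is every intersection of such
    sets; hence each J(v1) is closed, and the only noncompact J(v1) is the line
    itself. The family J is nested, so if some nonempty J(v1) is compact, the
    nonempty members form a chain of closed sets with a compact member and have
    a common point ([bigcap_chain_nonempty]); otherwise they are all equal to
    the line. The resulting intersection K is again the line or a nonempty
    compact interval, and contains its middle ([middle_mem]).

    The probabilistic part (ii) is a union bound ([mean_in_Jint]). The mean m
    can fall outside J(v) only by falling outside some I(v0) with v <= v0. Over
    the countable carrier D of nu, these exceptional events have probability at
    most 2 eps nu(v0), hence at most 2 eps nu(D) <= 2 eps in total. Off D the
    confidence level is 0, and the uncountably many exceptional events lie in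
    the single null set given by [level0_uniform]. On the event that J(v)
    contains m, it is one of the sets intersected in K, so it contains the
    adaptive estimator too. Two points of an interval are at distance at most
    its length, and J(v) is contained in every I(v0) with v < v0, whose length
    is twice the confidence bound. Part (iii) rewrites this bound by
    homogeneity, which is available at every v0 > v because v, a variance, is
    nonnegative. *)

(** * Intersections, intervals and infima *)

(** Cantor's intersection theorem for chains. The members of a chain of
    nonempty sets generate a proper filter; it clusters in the compact member,
    and a cluster point lies in the closure of every member. *)
Lemma bigcap_chain_nonempty (T : topologicalType) (I : Type) (D : set I)
    (F : I -> set T) (i0 : I) :
  D i0 -> compact (F i0) ->
  (forall i, D i -> closed (F i)) -> (forall i, D i -> F i !=set0) ->
  (forall i j, D i -> D j -> F i `<=` F j \/ F j `<=` F i) ->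
  \bigcap_(i in D) F i !=set0.
Proof.
move=> Di0 cptF clF F0 chain.
have filF : Filter (filter_from D F).
  apply: filter_from_filter; first by exists i0.
  move=> i j Di Dj; case: (chain _ _ Di Dj) => sF.
    by exists i => // t Ft; split => //; exact: sF.
  by exists j => // t Ft; split => //; exact: sF.
have [|p [_ clp]] := cptF _ (filter_from_proper filF F0).
  by exists i0.
exists p => i Di; apply: clF => //.
by move: clp; rewrite clusterE => /(_ (F i)); apply; exists i.
Qed.

(** The dichotomy that is preserved by intersections; bare closedness would not
    do for [Kint_nonempty], since nested unbounded closed sets can have an empty
    intersection. *)
Definition full_or_compact (T : topologicalType) (A : set T) : Prop :=
  A = setT \/ compact A.

Lemma full_or_compact_closed (T : topologicalType) (A : set T) :
  hausdorff_space T -> full_or_compact A -> closed A.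
Proof.
by move=> hT [->|cA]; [exact: closedT|exact: compact_closed].
Qed.

(** The intersection is closed, and lies in a compact member if there is one;
    otherwise all members are the whole space. *)
Lemma full_or_compact_bigcap (T : topologicalType) (I : Type) (D : set I)
    (F : I -> set T) : hausdorff_space T ->
  (forall i, D i -> full_or_compact (F i)) ->
  full_or_compact (\bigcap_(i in D) F i).
Proof.
move=> hT FD.
have [[i Di cFi]|ncpt] := pselect (exists2 i, D i & compact (F i)).
  right; apply: (@subclosed_compact _ _ (F i)) => //; last first.
    by move=> t; apply.
  by apply: closed_bigI => j Dj; exact: (full_or_compact_closed hT (FD j Dj)).
left; apply/seteqP; split=> // t _ i Di.
have [->//|cFi] := FD i Di.
by exfalso; apply: ncpt; exists i.
Qed.

Lemma is_interval_bigcap (R : realType) (I : Type) (D : set I)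
    (F : I -> set R) :
  (forall i, D i -> is_interval (F i)) -> is_interval (\bigcap_(i in D) F i).
Proof.
move=> FD x y Fx Fy z xzy i Di.
exact: (FD i Di x y (Fx i Di) (Fy i Di)).
Qed.

(** Unless [A] is a single point, the middle lies strictly between [inf A] and
    [sup A], hence between two elements of [A]. *)
Lemma middle_bounded_interval (R : realType) (A : set R) :
  A !=set0 -> has_ubound A -> has_lbound A -> is_interval A -> A (middle A).
Proof.
move=> A0 ubA lbA itvA; have [a Aa] := A0.
have lea x : A x -> inf A <= x <= sup A.
  by move=> Ax; rewrite (ge_inf lbA Ax) (ub_le_sup ubA Ax).
have /andP[ia sa] := lea _ Aa.
have [lt_is|le_si] := ltP (inf A) (sup A).
  have [y Ay ym] := inf_lt A0 (midf_lt lt_is).1.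
  have [z Az mz] := sup_gt A0 (midf_lt lt_is).2.
  by apply: (itvA y z) => //; rewrite (ltW ym) (ltW mz).
have -> // : middle A = a.
rewrite /middle.
have -> : sup A = a by apply/eqP; rewrite eq_le sa (le_trans le_si ia).
have -> : inf A = a by apply/eqP; rewrite eq_le ia (le_trans sa le_si).
by rewrite mulrDl -splitr.
Qed.

(** On the whole line, [middle] takes some default value, whose membership is
    trivial. *)
Lemma middle_mem (R : realType) (A : set R) :
  A !=set0 -> is_interval A -> full_or_compact A -> A (middle A).
Proof.
move=> A0 itvA [->//|cA].
have [M [_ /(_ (M + 1))]] := @compact_bounded R R^o A cA.
rewrite ltrDl ltr01 => /(_ isT) bA.
apply: middle_bounded_interval => //.
- by exists (M + 1) => x /bA; exact/le_trans/ler_norm.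
- exists (- (M + 1)) => x /bA /=; rewrite lerNl; apply: le_trans.
  by rewrite -normrN ler_norm.
Qed.

Lemma dist_le_lebesgue_interval (R : realType) (A : set R) (a b : R) :
  is_interval A -> A a -> A b -> (`|a - b|%:E <= lebesgue_measure A)%E.
Proof.
move=> itvA.
wlog ab : a b / a <= b => [hw Aa Ab|Aa Ab].
  have [ab|/ltW ba] := leP a b; first exact: hw.
  by rewrite distrC; exact: hw.
have -> : (`|a - b|%:E = lebesgue_measure (`[a, b]%classic : set R))%E.
  rewrite lebesgue_measure_itv /= lte_fin distrC ger0_norm ?subr_ge0//.
  have [//|ba] := ltP a b.
  by rewrite (@le_anti _ _ a b) ?ab ?subrr.
apply: le_measure; rewrite ?inE//; first exact: measurable_realfun.is_interval_measurable.
by move=> x /=; rewrite in_itv /=; exact: itvA.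
Qed.

Lemma le_mul_ereal_inf (R : realType) (c : R) (x : \bar R) (S : set \bar R) :
  0 < c -> (forall y, S y -> (x <= c%:E * y)%E) ->
  (x <= c%:E * ereal_inf S)%E.
Proof.
move=> c0 xS; rewrite -lee_pdivrMl//.
by apply: le_ereal_inf_tmp => y /xS; rewrite lee_pdivrMl.
Qed.

(** * Probability bounds and the union bound *)

Lemma with_prob_ge_subset (d : measure_display) (T : measurableType d)
    (R : realType) (P : probability T R) (p : R) (E F : set T) :
  E `<=` F -> with_prob_ge P p E -> with_prob_ge P p F.
Proof. by move=> EF [A [mA AE pA]]; exists A; split => // t /AE /EF. Qed.

(** Passing to exceptional sets turns lower bounds on inner probabilities into
    upper bounds on measures, to which subadditivity applies. *)
Lemma with_prob_ge_exceptional (d : measure_display) (T : measurableType d)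
    (R : realType) (P : probability T R) (c : R) (E : set T) :
  with_prob_ge P (1 - c) E <->
  exists B : set T, [/\ measurable B, ~` B `<=` E & (P B <= c%:E)%E].
Proof.
split=> [[A [mA AE pA]]|[B [mB BE pB]]].
  exists (~` A); split; [exact: measurableC|by rewrite setCK|].
  rewrite probability_setC//; move: pA.
  rewrite -(fineK (fin_num_measure P _ mA)) -EFinB !lee_fin.
  by rewrite !lerBlDr addrC.
exists (~` B); split => //; first exact: measurableC.
rewrite probability_setC//; move: pB.
rewrite -(fineK (fin_num_measure P _ mB)) -EFinB !lee_fin.
by move=> ?; rewrite lerD2l lerN2.
Qed.

(** The union is indexed by a set of reals, whereas sigma-additivity is about
    sequences. An injection [f] of [D] into the naturals cuts [D] into fibres
    [Dk k] that are empty or singletons. On each of them the bound is the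
    hypothesis; subadditivity of [P] and additivity of [nu] add them up. *)
Lemma countable_union_bound (d : measure_display) (T : measurableType d)
    (R : realType) (P : {measure set T -> \bar R})
    (nu : {measure set (measurableTypeR R) -> \bar R})
    (D : set R) (B : R -> set T) (c : R) :
  countable D -> (forall x, measurable (B x)) ->
  (forall x, D x -> (P (B x) <= c%:E * nu [set x])%E) ->
  measurable (\bigcup_(x in D) B x) /\
  (P (\bigcup_(x in D) B x) <= c%:E * nu D)%E.
Proof.
move=> cD mB PB.
have [f injf] := elimT (countable_injP D) cD.
pose Dk k : set (measurableTypeR R) := [set x | D x /\ f x = k].
have DkE k : Dk k = set0 \/ exists2 x, D x & Dk k = [set x].
  have [[x [Dx fx]]|nx] := pselect (exists x, Dk k x).
    right; exists x => //; apply/seteqP; split=> [y [Dy fy]|y ->//].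
    by apply: injf; rewrite ?inE// fy fx.
  by left; apply/seteqP; split=> // x Dx; apply: nx; exists x.
have mDk k : measurable (Dk k).
  by have [->|[x _ ->]] := DkE k; [exact: measurable0|exact: measurable_set1].
have DE : D = \bigcup_k Dk k.
  by apply/seteqP; split=> [x Dx|x [k _ []]//]; exists (f x).
have tDk : trivIset setT Dk.
  by move=> i j _ _ [x [[_ <-] [_ <-]]].
have mBk k : measurable (\bigcup_(x in Dk k) B x).
  have [->|[x _ ->]] := DkE k; first by rewrite bigcup_set0.
  by rewrite bigcup_set1.
have BE : \bigcup_(x in D) B x = \bigcup_k \bigcup_(x in Dk k) B x.
  apply/seteqP; split=> [t [x Dx Bt]|t [k _ [x [Dx _] Bt]]].
    by exists (f x) => //; exists x.
  by exists x.
have mU : measurable (\bigcup_(x in D) B x).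
  by rewrite BE; exact: bigcupT_measurable.
split => //.
have nuD : nu D = (\sum_(0 <= k <oo) nu (Dk k))%E.
  rewrite {1}DE measure_semi_bigcup//; exact: bigcupT_measurable.
rewrite nuD -nneseriesZl//.
apply: (@le_trans _ _ (\sum_(0 <= k <oo) P (\bigcup_(x in Dk k) B x))%E).
  by apply: measure_sigma_subadditive => //; rewrite BE.
apply: lee_nneseries => // k _.
have [->|[x Dx ->]] := DkE k.
  by rewrite bigcup_set0 !measure0 mule0.
by rewrite bigcup_set1; exact: PB.
Qed.

(** * The intervals I, J and K *)

Section intervals.
Context {R : realType} {n : nat}.
Variables
  (thetahat : R -> {mfun n.-tuple (measurableTypeR R) >-> measurableTypeR R})
  (delta : R -> R -> \bar R)
  (nu : subprobability (measurableTypeR R) R) (eps : R).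

Local Notation I := (Iint thetahat delta nu eps).
Local Notation J := (Jint thetahat delta nu eps).
Local Notation K := (Kint thetahat delta nu eps).

Lemma is_interval_Iint x v0 : is_interval (I x v0).
Proof. by rewrite /Iint; case: ifP => _ //; exact: interval_is_interval. Qed.

Lemma full_or_compact_Iint x v0 : full_or_compact (I x v0 : set R).
Proof.
by rewrite /Iint; case: ifP => _; [right; exact: segment_compact|left].
Qed.

Lemma is_interval_Jint x v1 : is_interval (J x v1).
Proof. by apply: is_interval_bigcap => v0 _; exact: is_interval_Iint. Qed.

Lemma full_or_compact_Jint x v1 : full_or_compact (J x v1 : set R).
Proof.
apply: full_or_compact_bigcap; first exact: norm_hausdorff.
by move=> v0 _; exact: full_or_compact_Iint.
Qed.

Lemma closed_Jint x v1 : closed (J x v1).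
Proof.
apply: full_or_compact_closed; first exact: norm_hausdorff.
exact: full_or_compact_Jint.
Qed.

Lemma Jint_nondecreasing x v1 v2 : v1 <= v2 -> J x v1 `<=` J x v2.
Proof. by move=> v12 t Jt v0 /= v20; apply: Jt => /=; exact: le_trans v20. Qed.

Lemma is_interval_Kint x : is_interval (K x).
Proof. by apply: is_interval_bigcap => v1 _; exact: is_interval_Jint. Qed.

Lemma full_or_compact_Kint x : full_or_compact (K x : set R).
Proof.
apply: full_or_compact_bigcap; first exact: norm_hausdorff.
by move=> v1 _; exact: full_or_compact_Jint.
Qed.

(** If none of the nonempty [J x v1] is compact they are all the whole line, and
    any point, such as 0, will do. This covers the case where no [J x v1] is
    nonempty. *)
Lemma Kint_nonempty x : K x !=set0.
Proof.
set D := [set v1 | 0 <= v1 /\ J x v1 !=set0].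
have [[v1 Dv1 cJ]|ncpt] := pselect (exists2 v1, D v1 & compact (J x v1 : set R)).
  apply: (bigcap_chain_nonempty Dv1 cJ) => [v2 _|v2 []//|v2 v3 _ _].
  - exact: closed_Jint.
  - by have [/Jint_nondecreasing|/ltW/Jint_nondecreasing] := leP v2 v3;
      [left|right].
exists 0 => v1 Dv1.
have [->//|cJ] := full_or_compact_Jint x v1.
by exfalso; apply: ncpt; exists v1.
Qed.

(** When the radius is finite, nonnegativity makes it a real number, so that
    [fine] loses nothing; when it is infinite there is nothing to prove. *)
Lemma mem_Iint x v0 t :
  (0 <= delta v0 (eps * mass nu v0))%E ->
  (`|t - thetahat v0 x|%:E <= delta v0 (eps * mass nu v0))%E -> I x v0 t.
Proof.
move=> d0; rewrite /Iint; case: ifPn => // dfin le_td.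
have /fineK dE : delta v0 (eps * mass nu v0) \is a fin_num.
  by rewrite ge0_fin_numE.
by move: le_td; rewrite -dE lee_fin ler_distl /= in_itv.
Qed.

(** [J x v1] is contained in [I x v0], of length twice the radius. An infinite
    radius gives the bound +oo. *)
Lemma lebesgue_Jint_le x v1 v0 :
  v1 <= v0 -> (0 <= delta v0 (eps * mass nu v0))%E ->
  (lebesgue_measure (J x v1) <= 2%:E * delta v0 (eps * mass nu v0))%E.
Proof.
move=> v10 d0.
apply: (@le_trans _ _ (lebesgue_measure (I x v0))).
  apply: le_measure; rewrite ?inE.
  - by apply: measurable_realfun.is_interval_measurable; exact: is_interval_Jint.
  - by apply: measurable_realfun.is_interval_measurable; exact: is_interval_Iint.
  - by move=> t; apply.
rewrite /Iint; case: ifPn => [dfin|].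
  have dE : (fine (delta v0 (eps * mass nu v0)))%:E = delta v0 (eps * mass nu v0).
    by rewrite fineK// ge0_fin_numE.
  have : 0 <= fine (delta v0 (eps * mass nu v0)) by exact: fine_ge0.
  rewrite -{4}dE; move: (fine _) => r r0.
  rewrite lebesgue_measure_itv /= lte_fin; case: ifPn => _.
    by rewrite -EFinD lee_fin opprB addrC addrA subrK mulr_natl mulr2n.
  by rewrite mule_ge0.
by rewrite -leNgt leye_eq => /eqP ->; rewrite gt0_muley ?leey.
Qed.

End intervals.

(** * The mean lies in J(v) with high probability *)

(** At the points [v0] of the countable carrier [D] of [nu], [B v0] is the
    exceptional set of the confidence bound at level [eps * nu {v0}], and these
    sets are summed. Outside [D] the mass is 0, and the single null set [N]
    serves all the [v0] at once. *)
Lemma mean_in_Jint (d : measure_display) (T : measurableType d)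
  (R : realType) (P : probability T R) (n : nat)
  (X : {mfun T >-> n.-tuple (measurableTypeR R)}) (m v : R)
  (thetahat : R -> {mfun n.-tuple (measurableTypeR R) >-> measurableTypeR R})
  (delta : R -> R -> \bar R)
  (nu : subprobability (measurableTypeR R) R) (eps : R) :
  0 <= v -> 0 <= eps ->
  (forall v0 eta : R, 0 <= v0 -> 0 <= eta -> (0 <= delta v0 eta)%E) ->
  confidence_bound P X m v thetahat delta ->
  level0_uniform P X m v thetahat delta ->
  atomic_on_Rplus nu ->
  with_prob_ge P (1 - 2 * eps)
    [set w | Jint thetahat delta nu eps (X w) v m].
Proof.
move=> v_ge0 eps_ge0 delta_ge0 conf [N [mN PN0 sN]] [D [cD _ nuD0]].
have massE v0 : (mass nu v0)%:E = nu [set v0].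
  by rewrite fineK// fin_num_measure.
have level_ge0 v0 : 0 <= eps * mass nu v0.
  by rewrite mulr_ge0// fine_ge0.
pose good v0 := [set w |
  (`|m - thetahat v0 (X w)|%:E <= delta v0 (eps * mass nu v0)%R)%E].
have /choice[B HB] (v0 : R) : exists B : set T, [/\ measurable B,
    v <= v0 -> ~` B `<=` good v0 & (P B <= (2 * eps)%:E * nu [set v0])%E].
  (* The confidence bound is vacuous below v, and J(v) does not involve I(v0). *)
  have [vv0|_] := leP v v0; last first.
    by exists set0; split => //; rewrite measure0 mule_ge0// lee_fin mulr_ge0.
  have [B [mB Bg PB]] := (with_prob_ge_exceptional P _ _).1
    (conf v0 _ (le_trans v_ge0 vv0) (level_ge0 v0) vv0).
  by exists B; split => //; rewrite -massE -EFinM -mulrA.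
have [mU PU] : measurable (\bigcup_(x in D) B x) /\
    (P (\bigcup_(x in D) B x) <= (2 * eps)%:E * nu D)%E.
  by apply: countable_union_bound => // x; have [] := HB x.
apply/with_prob_ge_exceptional; exists ((\bigcup_(x in D) B x) `|` N); split.
- exact: measurableU.
- move=> w; rewrite setCU => -[nB nN] v0 /= vv0.
  have v0_ge0 := le_trans v_ge0 vv0.
  apply: mem_Iint; first exact: delta_ge0.
  have [Dv0|nDv0] := pselect (D v0).
    have [_ /(_ vv0) BG _] := HB v0.
    by apply: BG => Bw; apply: nB; exists v0.
  have -> : mass nu v0 = 0.
    rewrite /mass (_ : nu [set v0] = 0%E)//; apply/eqP.
    rewrite eq_le measure_ge0 andbT -nuD0 le_measure ?inE//; last by move=> x ->.
    by apply: measurableC; apply: countable_measurable.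
  rewrite mulr0.
  by apply: contrapT => nle; apply: nN; apply: sN => /(_ v0 vv0).
- apply: (le_trans (measureU2 _ _ _)) => //.
  rewrite -[leRHS]adde0; apply: leeD; last by rewrite -PN0.
  apply: (le_trans PU); rewrite -[leRHS]mule1 lee_wpmul2l ?lee_fin ?mulr_ge0//.
  apply: le_trans (sprobability_setT (s := nu)).
  by rewrite le_measure ?inE//; apply: countable_measurable.
Qed.

Theorem proposition6p1
  (R : realType) (d : measure_display) (T : measurableType d)
  (P : probability T R)
  (mu : probability (measurableTypeR R) R) (m v : R)
  (n : nat) (X : {mfun T >-> n.-tuple (measurableTypeR R)})
  (thetahat : R -> {mfun n.-tuple (measurableTypeR R) >-> measurableTypeR R})
  (delta : R -> R -> \bar R)
  (nu : subprobability (measurableTypeR R) R) (eps : R)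
  (X_sample : sample_of P mu X)
  (mu_int : mu.-integrable setT (fun x : R => x%:E))
  (mean_mu : ('E_mu[fun x : R => x] = m%:E)%E)
  (var_mu : ('V_mu[fun x : R => x] = v%:E)%E)
  (delta_ge0 : forall v0 eta : R, 0 <= v0 -> 0 <= eta -> (0 <= delta v0 eta)%E)
  (delta_conf : confidence_bound P X m v thetahat delta)
  (nu_atomic : atomic_on_Rplus nu)
  (eps_gt0 : 0 < eps) :
  let I := Iint thetahat delta nu eps in
  let J := Jint thetahat delta nu eps in
  let K := Kint thetahat delta nu eps in
  (* (i) *)
  [/\ forall x v1 v2, 0 <= v1 -> v1 <= v2 -> J x v1 `<=` J x v2,
      forall x v1, 0 <= v1 -> closed_interval (J x v1),
      forall x, K x !=set0 /\ closed_interval (K x) &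
      adaptive_estimator thetahat delta nu eps (fun x => middle (K x))]
  /\
  (level0_uniform P X m v thetahat delta ->
   forall thetatilde, adaptive_estimator thetahat delta nu eps thetatilde ->
   (* (ii) *)
   [/\ with_prob_ge P (1 - 2 * eps) [set w | J (X w) v m],
       forall w, J (X w) v m ->
         J (X w) v !=set0 /\ J (X w) v (thetatilde (X w)) &
       with_prob_ge P (1 - 2 * eps)
         [set w |
           (`|m - thetatilde (X w)|%:E <= lebesgue_measure (J (X w) v))%E /\
           (lebesgue_measure (J (X w) v) <=
             2%:E * ereal_inf [set delta v0 (eps * mass nu v0)%R
                              | v0 in [set v0 : R | (v < v0)%R]])%E]]
   /\
   (* (iii) *)
   ((forall v0 eta : R, 0 < v0 -> 0 <= eta ->
       delta v0 eta = (delta 1%R eta * (Num.sqrt v0)%:E)%E) ->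
    with_prob_ge P (1 - 2 * eps)
      [set w |
        (`|m - thetatilde (X w)|%:E <=
          2%:E * ereal_inf [set delta 1%R (eps * mass nu v0)%R * (Num.sqrt v0)%:E
                           | v0 in [set v0 : R | (v < v0)%R]])%E])).
Proof.
move=> I J K.
have v_ge0 : 0 <= v by rewrite -lee_fin -var_mu variance_ge0.
have level_ge0 v0 : 0 <= eps * mass nu v0.
  by rewrite mulr_ge0 ?(ltW eps_gt0)// fine_ge0.
split.
  split.
  - by move=> x v1 v2 _; exact: Jint_nondecreasing.
  - by move=> x v1 _; split; [exact: closed_Jint|exact: is_interval_Jint].
  - move=> x; split; first exact: Kint_nonempty.
    split; last exact: is_interval_Kint.
    apply: full_or_compact_closed; first exact: norm_hausdorff.
    exact: full_or_compact_Kint.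
  - move=> x; apply: middle_mem; first exact: Kint_nonempty.
    + exact: is_interval_Kint.
    + exact: full_or_compact_Kint.
move=> level0 thetatilde adapt.
have m_in_J : with_prob_ge P (1 - 2 * eps) [set w | J (X w) v m].
  exact: (mean_in_Jint v_ge0 (ltW eps_gt0)).
have tilde_in_J w : J (X w) v m -> J (X w) v (thetatilde (X w)).
  (* J(v) is nonempty and 0 <= v, so it is one of the sets intersected in K. *)
  by move=> Jm; apply: (adapt (X w)); split => //; exists m.
have bounds : with_prob_ge P (1 - 2 * eps)
    [set w |
      (`|m - thetatilde (X w)|%:E <= lebesgue_measure (J (X w) v))%E /\
      (lebesgue_measure (J (X w) v) <=
        2%:E * ereal_inf [set delta v0 (eps * mass nu v0)%R
                         | v0 in [set v0 : R | (v < v0)%R]])%E].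
  apply: with_prob_ge_subset m_in_J => w /= Jm; split.
    apply: dist_le_lebesgue_interval => //; first exact: is_interval_Jint.
    exact: tilde_in_J.
  apply: le_mul_ereal_inf => // _ [v0 /= /ltW vv0 <-].
  by apply: lebesgue_Jint_le => //; apply: delta_ge0 => //; exact: le_trans vv0.
split.
  by split => // w Jm; split; [exists m|exact: tilde_in_J].
move=> hom; apply: with_prob_ge_subset bounds => w /= [le1 le2].
apply: (le_trans le1); apply: (le_trans le2).
rewrite (eq_imagel (f' := fun v0 =>
  delta 1%R (eps * mass nu v0)%R * (Num.sqrt v0)%:E)%E)// => v0 /= vv0.
by apply: hom => //; exact: le_lt_trans vv0.
Qed.
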